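(* Consider the CBI-process on $\mathbb{R}_+$ with generator $$Lf(x)=axf''(x)-bxf'(x)+x\int_0^\infty[f(x+y)-f(x)-yf'(x)]\,n_1(dy)+\delta f'(x)+\int_0^\infty[f(x+y)-f(x)]\,n_2(dy),$$ where $a,b,\delta\ge 0$ and $n_1,n_2$ are measures on $(0,\infty)$ with $\int_0^\infty\min\{y^2,y\}n_1(dy)+\int_{(0,1)}y\,n_2(dy)+\int_{[1,\infty)}(1+\log y)\,n_2(dy)<\infty$, and such that neither $R\equiv0$ nor $F\equiv0$. If this process has a nondegenerate (i.e. not a point mass) reversible distribution, then the process is a CIR model, i.e. $n_1\equiv0$, $n_2\equiv0$ and $a>0$, $b>0$, $\delta>0$.
   Context: $R(\lambda)=-a\lambda^2-b\lambda-\int_0^\infty(e^{-\lambda y}-1+\lambda y)n_1(dy)$ and $F(\lambda)=\delta\lambda+\int_0^\infty(1-e^{-\lambda y})n_2(dy)$ for $\lambda\ge0$. A probability measure $\nu$ on $\mathbb{R}_+$ is reversible if it is stationary and the bilinear form $\mathcal{E}(f,g)=-\int Lf\cdot g\,d\nu$ is symmetric on the domain of $L$ (which contains the functions $x\mapsto e^{-\lambda x}$, $\lambda\ge0$). In the CIR case the stationary distribution is the gamma distribution with parameter $(\delta/a,b/a)$. *)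

(* Defs.v *)
From HB Require Import structures.
From mathcomp Require Import all_boot all_order all_algebra.
From mathcomp Require Import all_classical all_reals all_analysis.
Set Implicit Arguments. Unset Strict Implicit. Unset Printing Implicit Defensive.
Import Order.TTheory GRing.Theory Num.Theory.
Import numFieldNormedType.Exports.
Local Open Scope classical_set_scope.
Local Open Scope ring_scope.

Definition Rbr {R : realType} (a b : R) (n1 : {measure set R -> \bar R}) (l : R) : R :=
  - a * l ^+ 2 - b * l
  - Rintegral n1 `]0, +oo[ (fun y => expR (- l * y) - 1 + l * y).

Definition Fim {R : realType} (delta : R) (n2 : {measure set R -> \bar R}) (l : R) : R :=
  delta * l + Rintegral n2 `]0, +oo[ (fun y => 1 - expR (- l * y)).

Definition gen {R : realType} (a b delta : R) (n1 n2 : {measure set R -> \bar R})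
  (f : R -> R) (x : R) : R :=
  a * x * (derive1n 2 f) x - b * x * derive1 f x
  + x * Rintegral n1 `]0, +oo[ (fun y => f (x + y) - f x - y * derive1 f x)
  + delta * derive1 f x
  + Rintegral n2 `]0, +oo[ (fun y => f (x + y) - f x).

Definition levy_cond {R : realType} (n1 n2 : {measure set R -> \bar R}) : Prop :=
  let Ppos : set R := `]0, +oo[%classic in
  let S01 : set R := `]0, 1[%classic in
  let B1 : set R := `[1, +oo[%classic in
  let J1 := (\int[n1]_(y in Ppos) (Num.min (y ^+ 2) y)%:E)%E in
  let J2 := (\int[n2]_(y in S01) y%:E)%E in
  let J3 := (\int[n2]_(y in B1) (1 + ln y)%:E)%E in
  (J1 + J2 + J3 < +oo)%E.

Definition expfun {R : realType} (l : R) : R -> R := fun x => expR (- l * x).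

(* nu (a probability measure on R, concentrated on R_+) is reversible for the
   generator L with domain D: stationary and the Dirichlet form is symmetric. *)
Definition reversible {R : realType} (L : (R -> R) -> R -> R) (D : set (R -> R))
  (nu : probability R R) : Prop :=
  (forall f, D f ->
     nu.-integrable `[0, +oo[ (EFin \o L f) /\
     Rintegral nu `[0, +oo[ (L f) = 0) /\
  (forall f g, D f -> D g ->
     nu.-integrable `[0, +oo[ (EFin \o (L f \* g)) /\
     nu.-integrable `[0, +oo[ (EFin \o (f \* L g)) /\
     Rintegral nu `[0, +oo[ (L f \* g) = Rintegral nu `[0, +oo[ (f \* L g)).

(* Main.v *)
(* Write [R], [F] for [Rbr a b n1], [Fim delta n2], and [psi], [phi] for
   [laplace nu], [laplace1 nu], the integrals of [e^(-sx)] and [x e^(-sx)]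
   against [nu]. Since
   [L e_l (x) = - (x R(l) + F(l)) e^(-lx)], testing the symmetry of the Dirichlet
   form on exponentials gives, with [s = l + m],
     [(R(l) - R(m)) phi(s) + (F(l) - F(m)) psi(s) = 0],
   so [R phi(s) + F psi(s)] is symmetric about [s/2] on [[0, s]], and its third
   difference over [0, 1, 2, 3] vanishes for [s = 3]. Quadratic polynomials have
   no third difference, and what remains is
     [phi(3) n1((1 - e^(-y))^3) + psi(3) n2((1 - e^(-y))^3) = 0],
   whence [n1 = n2 = 0] as [phi(3)] and [psi(3)] are positive. Then [m = 0] gives
   [(a s + b) phi(s) = delta psi(s)]: if [a = 0] then [phi / psi] is constant and
   [nu] is a point mass; if [b = 0] then [s -> 0] gives [delta = 0]. *)
Require Import Defs.
From HB Require Import structures.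
From mathcomp Require Import all_boot all_order all_algebra.
From mathcomp Require Import all_classical all_reals all_analysis.
From mathcomp Require Import measurable_realfun ring lra.

Import Order.TTheory GRing.Theory Num.Theory.
Import numFieldNormedType.Exports.
Local Open Scope classical_set_scope.
Local Open Scope ring_scope.
Set Implicit Arguments.
Unset Strict Implicit.
Unset Printing Implicit Defensive.

(** * Vanishing integrals, null sets and integrability on unions *)

Lemma ge0_Rintegral_eq0 d (T : measurableType d) (R : realType)
    (mu : {measure set T -> \bar R}) (D : set T) (f : T -> R) :
  measurable D -> mu.-integrable D (EFin \o f) ->
  (forall x, D x -> 0 <= f x) -> Rintegral mu D f = 0 ->
  mu (D `&` f @^-1` [set~ 0]) = 0%E.
Proof.
move=> mD If f0 Hf; have mf := measurable_int _ If.
(* Integrability matters here: [fine] sends [+oo] to 0 as well, so a zero [Rintegral] alone does not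
   give a zero extended integral. *)
have If0 : (\int[mu]_(x in D) (f x)%:E)%E = 0%E.
  by rewrite -(fineK (integrable_fin_num mD If)) [fine _]Hf.
have /(ae_eq_integral_abs mu mD mf) : (\int[mu]_(x in D) `|(EFin \o f) x|)%E = 0%E.
  rewrite -[RHS]If0; apply: eq_integral => x /set_mem Dx /=.
  by rewrite ger0_norm ?f0.
move=> [N [mN N0 sub]].
have mD0 : measurable (D `&` f @^-1` [set~ 0]).
  have /measurable_EFinP mf' := mf.
  exact: (mf' mD _ (measurableC (measurable_set1 0))).
apply: (subset_measure0 mD0 mN _ N0) => x [Dx fx0].
by apply: sub => /= /(_ Dx) [].
Qed.

Lemma gt0_Rintegral_eq0 d (T : measurableType d) (R : realType)
    (mu : {measure set T -> \bar R}) (D : set T) (f : T -> R) :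
  measurable D -> mu.-integrable D (EFin \o f) ->
  (forall x, D x -> 0 < f x) -> Rintegral mu D f = 0 -> mu D = 0%E.
Proof.
move=> mD If f0 Hf.
rewrite -(ge0_Rintegral_eq0 mD If (fun x Dx => ltW (f0 x Dx)) Hf).
congr (mu _); apply/esym/setIidPl => x Dx /=.
exact/eqP/lt0r_neq0/f0.
Qed.

Lemma integrable_setU d (T : measurableType d) (R : realType)
    (mu : {measure set T -> \bar R}) (A B : set T) (f : T -> \bar R) :
  measurable A -> measurable B -> [disjoint A & B] ->
  mu.-integrable A f -> mu.-integrable B f -> mu.-integrable (A `|` B) f.
Proof.
move=> mA mB AB /integrableP[mfA iA] /integrableP[mfB iB].
have mf : measurable_fun (A `|` B) f by apply/measurable_funU.
apply/integrableP; split => //.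
rewrite ge0_integral_setU //; first by rewrite lte_add_pinfty.
exact: measurableT_comp.
Qed.

Lemma Rintegral_null_set d (T : measurableType d) (R : realType)
    (mu : {measure set T -> \bar R}) (D : set T) (f : T -> R) :
  measurable D -> measurable_fun D f -> mu D = 0%E -> Rintegral mu D f = 0.
Proof.
by move=> mD mf D0; rewrite /Rintegral null_set_integral //; exact/measurable_EFinP.
Qed.

(** * Integrability of the jump integrands of [R] and [F] *)

Lemma expRN_sub_le_sqr (R : realType) (t : R) :
  0 <= t -> expR (- t) - 1 + t <= t ^+ 2.
Proof.
move=> t0; have t1 := expR_ge1Dx t; have p := expR_gt0 (- t).
have e1 : expR t * expR (- t) = 1 by rewrite expRN mulfV // gt_eqF ?expR_gt0.
have h : (1 + t) * expR (- t) <= 1 by rewrite -[leRHS]e1 ler_pM2r.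
(* The positive factor [1 + t] can be cancelled; since [(1 + t)(1 - t + t^2) = 1 + t^3], the
   right-hand side is at least 1. *)
suff : (1 + t) * expR (- t) <= (1 + t) * (1 - t + t ^+ 2).
  by rewrite ler_pM2l; [move=> ? |]; lra.
apply: (le_trans h).
have -> : (1 + t) * (1 - t + t ^+ 2) = 1 + t ^+ 3 by ring.
by rewrite lerDl exprn_ge0.
Qed.

Lemma measurable_expRM (R : realType) (l : R) (D : set R) :
  measurable_fun D (fun y : R => expR (l * y)).
Proof.
by apply: measurableT_comp => //; apply: measurable_funM => //; exact: measurable_cst.
Qed.

Lemma levy_cond_split (R : realType) (n1 n2 : {measure set R -> \bar R}) :
  levy_cond n1 n2 ->
  n1.-integrable `]0, +oo[ (fun y : R => (Num.min (y ^+ 2) y)%:E) /\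
  n2.-integrable `]0, 1[ (fun y : R => y%:E) /\
  n2.-integrable `[1, +oo[ (fun y : R => (1 + ln y)%:E).
Proof.
rewrite /levy_cond /=.
set J1 := (\int[n1]_(y in _) _)%E; set J2 := (\int[n2]_(y in _) _)%E.
set J3 := (\int[n2]_(y in _) _)%E.
have g1 : forall y : R, `]0, +oo[%classic y -> (0 <= (Num.min (y ^+ 2) y)%:E)%E.
  move=> y /=; rewrite in_itv /= andbT => y0.
  by rewrite lee_fin le_min sqr_ge0 ltW.
have g2 : forall y : R, `]0, 1[%classic y -> (0 <= y%:E)%E.
  by move=> y /=; rewrite in_itv /= => /andP[y0 _]; rewrite lee_fin ltW.
have g3 : forall y : R, `[1, +oo[%classic y -> (0 <= (1 + ln y)%:E)%E.
  move=> y /=; rewrite in_itv /= andbT => y1.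
  by rewrite lee_fin addr_ge0 // ln_ge0.
have J10 : (0 <= J1)%E by exact: integral_ge0.
have J20 : (0 <= J2)%E by exact: integral_ge0.
have J30 : (0 <= J3)%E by exact: integral_ge0.
move=> fin.
have J1f : (J1 < +oo)%E by apply: le_lt_trans fin; rewrite -addeA leeDl // adde_ge0.
have J2f : (J2 < +oo)%E.
  by apply: le_lt_trans fin; rewrite [(J1 + J2)%E]addeC -addeA leeDl // adde_ge0.
have J3f : (J3 < +oo)%E by apply: le_lt_trans fin; rewrite leeDr // adde_ge0.
split; last split; apply/integrableP; split.
- apply/measurable_EFinP; apply: measurable_funTS.
  by apply: measurable_minr => //; exact: exprn_measurable.
- rewrite (eq_integral (fun y : R => (Num.min (y ^+ 2) y)%:E)) // => y /set_mem Dy.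
  by rewrite gee0_abs // g1.
- by apply/measurable_EFinP; exact: measurable_id.
- rewrite (eq_integral (fun y : R => y%:E)) // => y /set_mem Dy.
  by rewrite gee0_abs // g2.
- apply/measurable_EFinP; apply: measurable_funTS.
  by apply: measurable_funD => //; exact: measurable_ln.
- rewrite (eq_integral (fun y : R => (1 + ln y)%:E)) // => y /set_mem Dy.
  by rewrite gee0_abs // g3.
Qed.

(** With [t = l y], the integrand lies between 0 and both [t^2] and [t]. The first bound serves when
    [y^2 <= y], the second otherwise, so [(l^2 + l) min(y^2, y)] dominates it. *)
Lemma integrable_R_integrand (R : realType) (n1 n2 : {measure set R -> \bar R}) (l : R) :
  levy_cond n1 n2 -> 0 <= l ->
  n1.-integrable `]0, +oo[ (EFin \o (fun y : R => expR (- l * y) - 1 + l * y)).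
Proof.
move=> /levy_cond_split [I1 _] l0.
have := integrableZl (measurable_itv _) (l ^+ 2 + l) I1.
apply: le_integrable => //.
- apply/measurable_EFinP; apply: measurable_funD.
    by apply: measurable_funB => //; exact: measurable_expRM.
  by apply: measurable_funM.
move=> y /=; rewrite in_itv /= andbT => y0; rewrite lee_fin.
have ly0 : 0 <= l * y by rewrite mulr_ge0 // ltW.
have h1 : 0 <= expR (- l * y) - 1 + l * y.
  by have := expR_ge1Dx (- l * y); lra.
have m0 : 0 <= Num.min (y ^+ 2) y by rewrite le_min sqr_ge0 ltW.
rewrite ger0_norm // ger0_norm; last by rewrite mulr_ge0 // addr_ge0 ?sqr_ge0.
have [yy|yy] := leP (y ^+ 2) y.
  have := expRN_sub_le_sqr ly0; rewrite -mulNr.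
  move/le_trans; apply; rewrite exprMn ler_wpM2r ?sqr_ge0 //; lra.
have : expR (- l * y) <= 1 by rewrite -expR0 ler_expR mulNr oppr_le0.
have := mulr_ge0 (sqr_ge0 l) (ltW y0); nra.
Qed.

(** Small and large jumps are treated apart: [l y] dominates on []0, 1[], and the constant 1, hence
    [1 + ln y], on [[1, +oo[]. *)
Lemma integrable_F_integrand (R : realType) (n1 n2 : {measure set R -> \bar R}) (l : R) :
  levy_cond n1 n2 -> 0 <= l ->
  n2.-integrable `]0, +oo[ (EFin \o (fun y : R => 1 - expR (- l * y))).
Proof.
move=> /levy_cond_split [_ [I2 I3]] l0.
have mf (D : set R) : measurable_fun D (EFin \o (fun y : R => 1 - expR (- l * y))).
  by apply/measurable_EFinP; apply: measurable_funB => //; exact: measurable_expRM.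
have f0 (y : R) : 0 < y -> 0 <= 1 - expR (- l * y).
  by move=> y0; rewrite subr_ge0 -expR0 ler_expR mulNr oppr_le0 mulr_ge0 // ltW.
have -> : `]0, +oo[%classic = `]0, 1[%classic `|` `[1, +oo[%classic :> set R.
  apply/seteqP; split=> y /=; rewrite !in_itv /= !andbT.
    by move=> ->; case: (ltP y 1); [left|right].
  by case=> [/andP[]//|]; apply: lt_le_trans.
apply: integrable_setU => //.
- apply/disj_set2P; apply/seteqP; split=> y //= []; rewrite !in_itv /= andbT.
  by move=> /andP[_ y1]; rewrite leNgt y1.
- have := integrableZl (measurable_itv _) l I2.
  apply: le_integrable => // y /=; rewrite in_itv /= => /andP[y0 _].
  rewrite lee_fin ger0_norm ?f0 // ger0_norm ?(mulr_ge0 l0 (ltW y0)) //.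
  by have := expR_ge1Dx (- l * y); lra.
- move: I3; apply: le_integrable => // y /=; rewrite in_itv /= andbT => y1.
  have ly := ln_ge0 y1.
  rewrite lee_fin ger0_norm ?f0 ?(lt_le_trans ltr01) // ger0_norm ?addr_ge0 //.
  by have := expR_gt0 (- l * y); lra.
Qed.

(** * The generator on exponentials *)

Lemma derive1_expfun (R : realType) (l : R) :
  derive1 (expfun l) = (fun x => - l * expR (- l * x)).
Proof.
apply/funext => x; rewrite derive1E /expfun.
have e : is_derive x (1:R) (fun x => expR (- l * x)) (- l * expR (- l * x)).
  apply: is_derive_eq; rewrite /GRing.scale /=; ring.
exact: derive_val.
Qed.

Lemma derive2_expfun (R : realType) (l : R) :
  derive1n 2 (expfun l) = (fun x => l ^+ 2 * expR (- l * x)).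
Proof.
rewrite derive1nS derive1n1 derive1_expfun; apply/funext => x; rewrite derive1E.
have e : is_derive x (1:R) (fun x => - l * expR (- l * x)) (l ^+ 2 * expR (- l * x)).
  apply: is_derive_eq; rewrite /GRing.scale /=; ring.
exact: derive_val.
Qed.

(** By [e^(-l(x+y)) = e^(-lx) e^(-ly)], the factor [e^(-lx)] comes out of every term; the Levy
    condition makes both jump integrands integrable, so that it can leave the integrals. *)
Lemma gen_expfun (R : realType) (a b delta : R) (n1 n2 : {measure set R -> \bar R})
    (l x : R) :
  levy_cond n1 n2 -> 0 <= l ->
  gen a b delta n1 n2 (expfun l) x =
  - (x * Rbr a b n1 l + Fim delta n2 l) * expR (- l * x).
Proof.
move=> lc l0.
rewrite /gen derive1_expfun derive2_expfun /Rbr /Fim.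
have -> : Rintegral n1 `]0, +oo[ (fun y => expfun l (x + y) - expfun l x
            - y * (- l * expR (- l * x))) =
    expR (- l * x) * Rintegral n1 `]0, +oo[ (fun y => expR (- l * y) - 1 + l * y).
  rewrite -RintegralZl //; last exact: integrable_R_integrand lc l0.
  by apply: eq_Rintegral => y _; rewrite /expfun mulrDr expRD; ring.
have -> : Rintegral n2 `]0, +oo[ (fun y => expfun l (x + y) - expfun l x) =
    - expR (- l * x) * Rintegral n2 `]0, +oo[ (fun y => 1 - expR (- l * y)).
  rewrite -RintegralZl //; last exact: integrable_F_integrand lc l0.
  by apply: eq_Rintegral => y _; rewrite /expfun mulrDr expRD; ring.
ring.
Qed.

(** * Third differences of [R] and [F] over 0, 1, 2, 3 *)

Lemma Rbr_third_difference (R : realType) (n1 n2 : {measure set R -> \bar R}) :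
  levy_cond n1 n2 ->
  let f := (fun y : R => (1 - expR (- y)) ^+ 3) in
  n1.-integrable `]0, +oo[ (EFin \o f) /\
  forall a b : R,
    Rbr a b n1 3 - 3 * Rbr a b n1 2 + 3 * Rbr a b n1 1 =
    Rintegral n1 `]0, +oo[ f.
Proof.
move=> lc f; pose P : set R := `]0, +oo[%classic.
pose g (l y : R) := expR (- l * y) - 1 + l * y.
have Ig l : 0 <= l -> n1.-integrable P (EFin \o g l).
  exact: integrable_R_integrand lc.
have mP : measurable P by exact: measurable_itv.
have I2 : n1.-integrable P (EFin \o (fun y => 3 * g 2 y)).
  exact: (integrableZl mP 3 (Ig 2 (ler0n _ _))).
have I1 : n1.-integrable P (EFin \o (fun y => 3 * g 1 y)).
  exact: (integrableZl mP 3 (Ig 1 ler01)).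
have I21 : n1.-integrable P (EFin \o (fun y => 3 * g 2 y - 3 * g 1 y)).
  exact: (integrableB mP I2 I1).
(* With [u = e^(-y)], the terms in [y] cancel and [1 - 3u + 3u^2 - u^3] remains; splitting the
   exponents lets [expRD] expose powers of [u]. The signs are reversed because [R] carries minus the
   integral. *)
have fE : f = (fun y => (3 * g 2 y - 3 * g 1 y) - g 3 y).
  apply/funext => y; rewrite /f /g.
  have -> : - 3%:R * y = - y + (- y + - y) by ring.
  have -> : - 2%:R * y = - y + - y by ring.
  rewrite !expRD mulN1r; ring.
split; first by rewrite fE; exact: (integrableB mP I21 (Ig 3 (ler0n _ _))).
move=> a b; rewrite fE RintegralB //; last exact: Ig.
rewrite RintegralB // !RintegralZl //; [|exact: Ig..].
rewrite /Rbr /g; ring.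
Qed.

(** This integrates [(1 - u)^3 = (1 - u^3) - 3(1 - u^2) + 3(1 - u)] at [u = e^(-y)]; the drift drops
    out, being linear in [l]. *)
Lemma Fim_third_difference (R : realType) (n1 n2 : {measure set R -> \bar R}) :
  levy_cond n1 n2 ->
  let f := (fun y : R => (1 - expR (- y)) ^+ 3) in
  n2.-integrable `]0, +oo[ (EFin \o f) /\
  forall delta : R,
    Fim delta n2 3 - 3 * Fim delta n2 2 + 3 * Fim delta n2 1 =
    Rintegral n2 `]0, +oo[ f.
Proof.
move=> lc f; pose P : set R := `]0, +oo[%classic.
pose g (l y : R) := 1 - expR (- l * y).
have Ig l : 0 <= l -> n2.-integrable P (EFin \o g l).
  exact: integrable_F_integrand lc.
have mP : measurable P by exact: measurable_itv.
have I2 : n2.-integrable P (EFin \o (fun y => 3 * g 2 y)).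
  exact: (integrableZl mP 3 (Ig 2 (ler0n _ _))).
have I1 : n2.-integrable P (EFin \o (fun y => 3 * g 1 y)).
  exact: (integrableZl mP 3 (Ig 1 ler01)).
have I32 : n2.-integrable P (EFin \o (fun y => g 3 y - 3 * g 2 y)).
  exact: (integrableB mP (Ig 3 (ler0n _ _)) I2).
have fE : f = (fun y => (g 3 y - 3 * g 2 y) + 3 * g 1 y).
  apply/funext => y; rewrite /f /g.
  have -> : - 3%:R * y = - y + (- y + - y) by ring.
  have -> : - 2%:R * y = - y + - y by ring.
  rewrite !expRD mulN1r; ring.
split; first by rewrite fE; exact: (integrableD mP I32 I1).
move=> delta; rewrite fE RintegralD //.
rewrite RintegralB //; last exact: Ig.
rewrite !RintegralZl //; [|exact: Ig..].
rewrite /Fim /g; ring.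
Qed.

(** * Laplace transform of [nu], and criteria for point masses *)

Section Laplace.
Variables (R : realType) (nu : probability R R).
Hypothesis nu_neg : nu `]-oo, 0[%classic = 0%E.
Let S : set R := `[0, +oo[%classic.
Let mS : measurable S := measurable_itv _.

Lemma probability_nonneg : nu S = 1%E.
Proof.
by rewrite /S -setCitvl probability_setC //= nu_neg sube0.
Qed.

Lemma eq_dirac (c : R) : nu [set~ c] = 0%E ->
  forall A : set R, measurable A -> nu A = \d_c A.
Proof.
move=> nuc A mA; rewrite diracE.
have mc : measurable [set~ c] by exact: (measurableC (measurable_set1 c)).
have [cA|cA] := boolP (c \in A).
  have : nu (~` A) = 0%E.
    apply: (subset_measure0 _ mc _ nuc); first exact: measurableC.
    by move=> x Ax xc; apply: Ax; rewrite xc -in_setE.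
  by move=> h; rewrite -[A]setCK probability_setC ?h ?sube0 //; exact: measurableC.
apply: (subset_measure0 mA mc _ nuc) => x Ax xc.
by move/negP: cA; apply; rewrite in_setE -xc.
Qed.

(** A zero integral makes [nu] live on the zeros of [f], among which only [c] is available; the
    negative half-line is null by [nu_neg]. *)
Lemma Rintegral_eq0_dirac (c : R) (f : R -> R) :
  nu.-integrable S (EFin \o f) -> (forall x, 0 <= x -> 0 <= f x) ->
  (forall x, 0 <= x -> f x = 0 -> x = c) -> Rintegral nu S f = 0 ->
  forall A : set R, measurable A -> nu A = \d_c A.
Proof.
move=> If f0 fc Hf; apply: eq_dirac.
have S0 x : S x -> 0 <= x by rewrite /S /= in_itv /= andbT.
have f0' x : S x -> 0 <= f x by move=> /S0; exact: f0.
have h := ge0_Rintegral_eq0 mS If f0' Hf.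
have mU : measurable (S `&` f @^-1` [set~ 0]).
  have /measurable_EFinP mf := measurable_int _ If.
  exact: (mf mS _ (measurableC (measurable_set1 0))).
have mN : measurable (`]-oo, 0[%classic : set R) by exact: measurable_itv.
have hU : nu ((S `&` f @^-1` [set~ 0]) `|` `]-oo, 0[%classic) = 0%E.
  by apply/eqP; rewrite -measure_le0 (le_trans (measureU2 _ _ _)) //
    [X in (X + _)%E]h [X in (_ + X)%E]nu_neg adde0.
apply: (subset_measure0 _ _ _ hU).
- exact: (measurableC (measurable_set1 c)).
- exact: measurableU.
move=> x xc; have [x0|x0] := leP 0 x; last by right; rewrite /= in_itv.
left; split; first by rewrite /S /= in_itv /= andbT.
by move=> fx0; apply: xc; exact: fc.
Qed.

Lemma nonneg_bounded_integrable (M : R) (f : R -> R) :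
  measurable_fun S f -> (forall x, 0 <= x -> `|f x| <= M) ->
  nu.-integrable S (EFin \o f).
Proof.
move=> mf fM; have := finite_measure_integrable_cst nu M mS.
apply: le_integrable => //; first exact/measurable_EFinP.
move=> x; rewrite /S /= in_itv /= andbT => /fM h.
by rewrite lee_fin (le_trans h) // ler_norm.
Qed.

Lemma integrable_expR (s : R) : 0 < s ->
  nu.-integrable S (EFin \o (fun x => expR (- s * x))).
Proof.
move=> s0; apply: (@nonneg_bounded_integrable 1); first exact: measurable_expRM.
move=> x x0; rewrite ger0_norm ?expR_ge0 // -expR0 ler_expR mulNr oppr_le0.
by rewrite mulr_ge0 // ltW.
Qed.

(** This is [s x <= e^(sx)], multiplied by [e^(-sx)] and divided by [s]. *)
Lemma mulr_expRN_le (s x : R) : 0 < s -> 0 <= x -> x * expR (- s * x) <= s^-1.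
Proof.
move=> s0 x0; have p := expR_gt0 (- s * x).
have e1 : expR (s * x) * expR (- s * x) = 1.
  by rewrite mulNr expRN mulfV // gt_eqF ?expR_gt0.
rewrite -(ler_pM2l s0) mulfV ?gt_eqF // -[leRHS]e1 mulrA ler_pM2r //.
by have := expR_ge1Dx (s * x); lra.
Qed.

Lemma integrable_mulr_expR (s : R) : 0 < s ->
  nu.-integrable S (EFin \o (fun x => x * expR (- s * x))).
Proof.
move=> s0; apply: (@nonneg_bounded_integrable s^-1).
  by apply: measurable_funM => //; exact: measurable_expRM.
move=> x x0; rewrite ger0_norm; first exact: mulr_expRN_le.
by rewrite mulr_ge0 ?expR_ge0.
Qed.

Definition laplace (s : R) := Rintegral nu S (fun x => expR (- s * x)).
(** For [s > 0] this is minus the derivative of [laplace]. At [s = 0] it would be the mean of [nu],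
    and [Rintegral] returns 0 if that is infinite; hence the identities below ask for [0 < s]. *)
Definition laplace1 (s : R) := Rintegral nu S (fun x => x * expR (- s * x)).

Lemma integrable_affine_expR (c d s : R) : 0 < s ->
  nu.-integrable S (EFin \o (fun x => (c * x + d) * expR (- s * x))).
Proof.
move=> s0.
have := integrableD mS (integrableZl mS c (integrable_mulr_expR s0))
                       (integrableZl mS d (integrable_expR s0)).
apply: eq_integrable => // x _ /=.
by rewrite -!EFinM -EFinD mulrDl mulrA.
Qed.

Lemma Rintegral_affine_expR (c d s : R) : 0 < s ->
  Rintegral nu S (fun x => (c * x + d) * expR (- s * x)) =
  c * laplace1 s + d * laplace s.
Proof.
move=> s0.
have I1 := integrable_mulr_expR s0; have I0 := integrable_expR s0.
rewrite /laplace1 /laplace -!RintegralZl // -RintegralD //.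
- by apply: eq_Rintegral => x _; rewrite mulrDl mulrA.
- exact: (integrableZl mS c I1).
- exact: (integrableZl mS d I0).
Qed.

Lemma laplace_ge0 (s : R) : 0 <= laplace s.
Proof. by apply: Rintegral_ge0 => x _; exact: expR_ge0. Qed.

Lemma laplace1_ge0 (s : R) : 0 <= laplace1 s.
Proof.
apply: Rintegral_ge0 => x; rewrite /S /= in_itv /= andbT => x0.
by rewrite mulr_ge0 // expR_ge0.
Qed.

Lemma laplace_gt0 (s : R) : 0 < s -> 0 < laplace s.
Proof.
move=> s0; rewrite lt_neqAle laplace_ge0 andbT; apply/negP => /eqP/esym h.
have : nu S = 0%E.
  by apply: gt0_Rintegral_eq0 h => //; [exact: integrable_expR|move=> x _; exact: expR_gt0].
by rewrite probability_nonneg; move/eqP; rewrite onee_eq0.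
Qed.

(** The integrand vanishes only at 0, so a zero integral would make [nu] the point mass at 0. *)
Lemma laplace1_gt0 (s : R) :
  ~ (exists x0 : R, forall A : set R, measurable A -> nu A = \d_x0 A) ->
  0 < s -> 0 < laplace1 s.
Proof.
move=> ndeg s0; rewrite lt_neqAle laplace1_ge0 andbT; apply/negP => /eqP/esym h.
apply: ndeg; exists 0; apply: Rintegral_eq0_dirac h.
- exact: integrable_mulr_expR.
- by move=> x x0; rewrite mulr_ge0 // expR_ge0.
- by move=> x _ /eqP; rewrite mulf_eq0 (gt_eqF (expR_gt0 _)) orbF => /eqP.
Qed.

(* At [x], the combination [e^(-c) * (s = 1) - (s = 2)] of the two integrands is
   [(x - c) (e^(-c) - e^(-x)) e^(-x)], nonnegative and null only at [c]. *)
Lemma laplace1_proportional (c : R) :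
  laplace1 1 = c * laplace 1 -> laplace1 2 = c * laplace 2 ->
  forall A : set R, measurable A -> nu A = \d_c A.
Proof.
move=> h1 h2.
(* The integral of [g s] is [laplace1 s - c * laplace s], which the hypotheses make 0 at [s = 1] and
   [s = 2]. *)
pose g (s x : R) := (1 * x + - c) * expR (- s * x).
have I1 : nu.-integrable S (EFin \o g 1) by exact: integrable_affine_expR.
have I2 : nu.-integrable S (EFin \o g 2) by exact: integrable_affine_expR.
have I1' : nu.-integrable S (EFin \o (fun x => expR (- c) * g 1 x)).
  exact: (integrableZl mS (expR (- c)) I1).
have fE x : expR (- c) * g 1 x - g 2 x = (x - c) * (expR (- c) - expR (- x)) * expR (- x).
  rewrite /g; have -> : - 2%:R * x = - x + - x by ring.
  by rewrite expRD mulN1r; ring.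
apply: (@Rintegral_eq0_dirac c (fun x => expR (- c) * g 1 x - g 2 x)).
- exact: (integrableB mS I1' I2).
- move=> x _; rewrite fE mulr_ge0 ?expR_ge0 //.
  have [xc|xc] := leP x c.
    by rewrite mulr_le0 ?subr_le0 // ler_expR lerN2.
  by rewrite mulr_ge0 ?subr_ge0 ?ler_expR ?lerN2 // ltW.
- move=> x _; rewrite fE => /eqP; rewrite !mulf_eq0 (gt_eqF (expR_gt0 _)) orbF.
  by case/orP; rewrite subr_eq0 => /eqP // /expR_inj /oppr_inj.
- rewrite RintegralB // RintegralZl // /g !Rintegral_affine_expR //.
  by rewrite h1 h2; ring.
Qed.

(* As [s] tends to 0, [s * laplace1 s] tends to 0 and [laplace s] to 1, by
   dominated convergence along [s = 1 / (n + 1)]. *)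
Lemma laplace1_hyperbolic (a d : R) :
  (forall s, 0 < s -> a * s * laplace1 s = d * laplace s) -> d = 0.
Proof.
move=> H.
pose h (n : nat) : R := harmonic n.
have h0 n : 0 < h n by exact: harmonic_gt0.
(* The integral of [f n] is the difference of the two sides of [H] at [s = h n], hence 0, while
   [f n] tends pointwise to [- d]. *)
pose f (n : nat) (x : R) := (a * h n * x + - d) * expR (- h n * x).
have f0 n : Rintegral nu S (f n) = 0.
  by rewrite /f Rintegral_affine_expR // H //; ring.
have If n : nu.-integrable S (EFin \o f n) by exact: integrable_affine_expR.
have Ic (k : R) := finite_measure_integrable_cst nu k mS.
have : (fun n => (\int[nu]_(x in S) (f n x)%:E)%E) @ \oo --> (\int[nu]_(x in S) (- d)%:E)%E.
  apply: (@dominated_cvg _ _ _ nu S mS (fun n x => (f n x)%:E) (fun=> (- d)%:E)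
    (fun=> (`|a| + `|d|)%:E)) => //.
  - by move=> n; exact: measurable_int (If n).
  - move=> x _; apply/fine_cvgP; split; first exact: filterE.
    have hc : h @ \oo --> (0 : R) by exact: cvg_harmonic.
    have c1 : (fun n => - h n * x) @ \oo --> - 0 * x.
      exact: (cvgM (cvgN hc) (cvg_cst x)).
    have c2 : (fun n => expR (- h n * x)) @ \oo --> expR (- 0 * x).
      by apply: continuous_cvg => //; exact: continuous_expR.
    have c3 : (fun n => a * h n * x + - d) @ \oo --> a * 0 * x + - d.
      exact: (cvgD (cvgM (cvgM (cvg_cst a) hc) (cvg_cst x)) (cvg_cst (- d))).
    have := cvgM c3 c2.
    by rewrite mulr0 mul0r add0r oppr0 mul0r expR0 mulr1 => lim; exact: lim.
  - exact: (Ic (`|a| + `|d|)).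
  (* The bound is uniform in [n]: [x e^(-hx) <= 1/h] absorbs the factor [h], and [e^(-hx) <= 1]. *)
  - move=> n x; rewrite /S /= in_itv /= andbT => x0.
    rewrite lee_fin /f mulrDl (le_trans (ler_normD _ _)) // lerD //.
      rewrite -!mulrA normrM ler_piMr //.
      rewrite ger0_norm ?mulr_ge0 ?expR_ge0 //; last exact: ltW.
      rewrite -(mulfV (lt0r_neq0 (h0 n))) ler_pM2l //.
      exact: mulr_expRN_le.
    rewrite normrM normrN ler_piMr // ger0_norm ?expR_ge0 //.
    by rewrite -expR0 ler_expR mulNr oppr_le0 mulr_ge0 // ltW.
have -> : (fun n => (\int[nu]_(x in S) (f n x)%:E)%E) = (fun=> 0%E).
  apply/funext => n; rewrite -(fineK (integrable_fin_num mS (If n))).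
  by rewrite [fine _]f0.
have -> : (\int[nu]_(x in S) (- d)%:E)%E = (- d)%:E.
  by rewrite integral_cst // [X in (_ * X)%E]probability_nonneg mule1.
move=> lim.
have e : 0%E = (- d)%:E by apply: (cvg_unique (@ereal_hausdorff R) _ lim); exact: cvg_cst.
by move: (congr1 fine e) => /=; lra.
Qed.

End Laplace.

(** * Reversibility tested on exponentials *)

Lemma Rbr_0 (R : realType) (a b : R) (n1 : {measure set R -> \bar R}) : Rbr a b n1 0 = 0.
Proof.
rewrite /Rbr (@eq_Rintegral _ _ _ _ _ (fun=> 0)); last first.
  by move=> y _; rewrite oppr0 !mul0r expR0; ring.
by rewrite Rintegral_cst // mul0r; ring.
Qed.

Lemma Fim_0 (R : realType) (delta : R) (n2 : {measure set R -> \bar R}) : Fim delta n2 0 = 0.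
Proof.
rewrite /Fim (@eq_Rintegral _ _ _ _ _ (fun=> 0)); last first.
  by move=> y _; rewrite oppr0 !mul0r expR0; ring.
by rewrite Rintegral_cst // mul0r; ring.
Qed.

(** Each side of the symmetry relation for [e_l] and [e_m] integrates an affine function of [x]
    times [e^(-(l+m)x)]; [0 < l + m] makes both parts integrable. *)
Lemma reversible_laplace (R : realType) (a b delta : R)
    (n1 n2 : {measure set R -> \bar R}) (D : set (R -> R)) (nu : probability R R) :
  levy_cond n1 n2 -> (forall l, 0 <= l -> D (expfun l)) ->
  reversible (gen a b delta n1 n2) D nu ->
  forall l m, 0 <= l -> 0 <= m -> 0 < l + m ->
  (Rbr a b n1 l - Rbr a b n1 m) * laplace1 nu (l + m)
  + (Fim delta n2 l - Fim delta n2 m) * laplace nu (l + m) = 0.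
Proof.
move=> lc De [_ sym] l m l0 m0 lm0.
have [_ [_]] := sym _ _ (De l l0) (De m m0).
rewrite (@eq_Rintegral _ _ _ _ _ (fun x : R =>
  (- Rbr a b n1 l * x + - Fim delta n2 l) * expR (- (l + m) * x))); last first.
  move=> x _ /=; rewrite gen_expfun // /expfun (_ : - (l + m) * x = - l * x + - m * x); last by ring.
  by rewrite expRD; ring.
rewrite [in RHS](@eq_Rintegral _ _ _ _ _ (fun x : R =>
  (- Rbr a b n1 m * x + - Fim delta n2 m) * expR (- (l + m) * x))); last first.
  move=> x _ /=; rewrite gen_expfun // /expfun (_ : - (l + m) * x = - l * x + - m * x); last by ring.
  by rewrite expRD; ring.
rewrite !Rintegral_affine_expR // => h; lra.
Qed.

(** * Vanishing of the jumps and positivity of the parameters *)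

Unset Implicit Arguments.

Theorem theorem2p3 (R : realType) (a b delta : R)
  (n1 n2 : {measure set R -> \bar R}) (D : set (R -> R))
  (nu : probability R R) :
  0 <= a -> 0 <= b -> 0 <= delta ->
  levy_cond n1 n2 ->
  (exists l, 0 <= l /\ Rbr a b n1 l != 0) ->
  (exists l, 0 <= l /\ Fim delta n2 l != 0) ->
  (forall l, 0 <= l -> D (expfun l)) ->
  nu `]-oo, 0[%classic = 0%E ->
  ~ (exists x0 : R, forall A : set R, measurable A -> nu A = \d_x0 A) ->
  reversible (gen a b delta n1 n2) D nu ->
  (forall A : set R, measurable A -> n1 (A `&` `]0, +oo[%classic) = 0%E) /\
  (forall A : set R, measurable A -> n2 (A `&` `]0, +oo[%classic) = 0%E) /\
  0 < a /\ 0 < b /\ 0 < delta.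
Proof.
move=> a0 b0 d0 lc [lR [lR0 Rne]] [lF [lF0 Fne]] De nu_neg ndeg rev.
have eqn := reversible_laplace lc De rev.
have [I1 c1] := Rbr_third_difference lc; have [I2 c2] := Fim_third_difference lc.
set f := (fun y : R => (1 - expR (- y)) ^+ 3) in I1 c1 I2 c2.
have mP : measurable (`]0, +oo[%classic : set R) by exact: measurable_itv.
have f0 (y : R) : `]0, +oo[%classic y -> 0 < f y.
  rewrite /= in_itv /= andbT => y0.
  by rewrite /f exprn_gt0 // subr_gt0 -expR0 ltr_expR oppr_lt0.
have phi3 : 0 < laplace1 nu 3 by exact: laplace1_gt0.
have psi3 : 0 < laplace nu 3 by exact: laplace_gt0.
have J1 : 0 <= Rintegral n1 `]0, +oo[ f by apply: Rintegral_ge0 => y /f0/ltW.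
have J2 : 0 <= Rintegral n2 `]0, +oo[ f by apply: Rintegral_ge0 => y /f0/ltW.
have sum0 : Rintegral n1 `]0, +oo[ f * laplace1 nu 3 +
    Rintegral n2 `]0, +oo[ f * laplace nu 3 = 0.
  (* The third difference is the identity for [(3, 0)] plus three times the one for [(1, 2)]; both
     have [l + m = 3], so they share the same [laplace1] and [laplace] values. *)
  have := eqn 3 0 (ler0n _ _) (lexx _); rewrite addr0 Rbr_0 Fim_0 => /(_ (ltr0n _ _)) e30.
  have := eqn 1 2 ler01 (ler0n _ _); rewrite (_ : 1 + 2 = 3 :> R); last by ring.
  move=> /(_ (ltr0n _ _)) e12.
  rewrite -(c1 a b) -(c2 delta).
  by lra.
have [Z1 Z2] : Rintegral n1 `]0, +oo[ f = 0 /\ Rintegral n2 `]0, +oo[ f = 0.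
  have p1 := mulr_ge0 J1 (ltW phi3); have p2 := mulr_ge0 J2 (ltW psi3).
  split; apply/eqP.
    by rewrite -(mulIr_eq0 _ (mulIf (lt0r_neq0 phi3))); apply/eqP; lra.
  by rewrite -(mulIr_eq0 _ (mulIf (lt0r_neq0 psi3))); apply/eqP; lra.
have N1 : n1 `]0, +oo[%classic = 0%E by exact: gt0_Rintegral_eq0 I1 f0 Z1.
have N2 : n2 `]0, +oo[%classic = 0%E by exact: gt0_Rintegral_eq0 I2 f0 Z2.
split; first by move=> A mA; apply: (subset_measure0 _ mP _ N1) => //; exact: measurableI.
split; first by move=> A mA; apply: (subset_measure0 _ mP _ N2) => //; exact: measurableI.
have RE l : 0 <= l -> Rbr a b n1 l = - (a * l + b) * l.
  move=> l0; rewrite /Rbr Rintegral_null_set //; first by ring.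
  by have /measurable_int/measurable_EFinP := integrable_R_integrand lc l0.
have FE l : 0 <= l -> Fim delta n2 l = delta * l.
  move=> l0; rewrite /Fim Rintegral_null_set //; first by ring.
  by have /measurable_int/measurable_EFinP := integrable_F_integrand lc l0.
have dpos : 0 < delta.
  by rewrite lt_neqAle d0 andbT; apply: contraNN Fne => /eqP dE; rewrite FE // -dE mul0r.
(* The identity for [(l, 0)], with the polynomial forms of [R] and [F], divided by [l]. *)
have key l : 0 < l -> (a * l + b) * laplace1 nu l = delta * laplace nu l.
  move=> l0; have := eqn l 0 (ltW l0) (lexx _).
  rewrite addr0 => /(_ l0); rewrite Rbr_0 Fim_0 RE ?ltW // FE ?ltW // => e.
  apply: (mulfI (lt0r_neq0 l0)); lra.
split.
  rewrite lt_neqAle a0 andbT; apply/negP => /eqP a00; subst a.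
  have bpos : 0 < b.
    rewrite lt_neqAle b0 andbT; apply: contraNN Rne => /eqP bE.
    by rewrite RE // -bE mul0r addr0 oppr0 mul0r.
  (* With [a = 0], [key] says that [laplace1 / laplace] is constantly [delta / b], so this is where
     the point mass must sit. *)
  apply: ndeg; exists (delta / b).
  by apply: laplace1_proportional => //; rewrite mulrAC -key // mul0r add0r mulrC mulKf // gt_eqF.
(* With [b = 0], [key] becomes the hypothesis of [laplace1_hyperbolic], whose conclusion contradicts
   [dpos]. *)
split=> //; rewrite lt_neqAle b0 andbT; apply/negP => /eqP b00; subst b.
suff : delta = 0 by move=> dd; rewrite dd ltxx in dpos.
apply: (laplace1_hyperbolic nu_neg (a := a)) => s s0.
by rewrite -key // addr0.
Qed.
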